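(* Let $d\ge 1$ and $n\ge 1$ be integers. For every nonzero polynomial $P\in\mathbb R[x_1,\ldots,x_d]$ of degree $n$, there exists a point of the unit ball $B^d\subset\mathbb R^d$ at distance at least $\frac1n$ from the zero set of the polynomial $P$.
   Context: $B^d=\{x\in\mathbb R^d : |x|\le 1\}$ is the closed Euclidean unit ball. The zero set of $P$ is $\{x\in\mathbb R^d : P(x)=0\}$. Distance is Euclidean; ''a point is at distance at least $r$ from a set $Z$'' means that every point of $Z$ is at distance at least $r$ from it (vacuously true if $Z$ is empty). *)

(* Defs.v *)
From HB Require Import structures.
From mathcomp Require Import all_boot all_order all_algebra.
From mathcomp Require Import classical_sets reals.
From mathcomp Require Import mpoly.

Set Implicit Arguments.
Unset Strict Implicit.
Unset Printing Implicit Defensive.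

Import Order.TTheory GRing.Theory Num.Theory.

Local Open Scope classical_set_scope.
Local Open Scope ring_scope.

(* The norm that MathComp-Analysis puts on 'rV[R]_d is the sup norm, hence
   this separate Euclidean norm. *)
Definition enorm (R : realType) (d : nat) (x : 'rV[R]_d) : R :=
  Num.sqrt (\sum_(i < d) x ord0 i ^+ 2).

Definition unit_ball (R : realType) (d : nat) : set 'rV[R]_d :=
  [set x | enorm x <= 1].

Definition zero_set (R : realType) (d : nat) (P : {mpoly R[d]}) :
    set 'rV[R]_d :=
  [set x | P.@[fun i => x ord0 i] = 0].

(* Stated pointwise so that it holds vacuously when [Z] is empty (an infimum
   of distances in R would be 0 there). *)
Definition at_distance_ge (R : realType) (d : nat) (r : R) (x : 'rV[R]_d)
    (Z : set 'rV[R]_d) : Prop :=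
  forall z, Z z -> r <= enorm (x - z).

(* Main.v *)
Require Import Defs.
From HB Require Import structures.
From mathcomp Require Import all_boot all_order all_algebra.
From mathcomp Require Import classical_sets reals.
From mathcomp Require Import mpoly.
From mathcomp Require Import boolp topology normedtype derive trigo.
From mathcomp Require Import ring lra.

(** The proof transfers the problem to the unit sphere of R^(d+1), where it
    follows from a classical theorem of M. Riesz: a trigonometric polynomial of
    degree N that attains its maximal modulus at 0 has no zero t with
    0 <= t < pi / (2 N) ([circle_form_max_no_zero]).  Applied on great circles, it
    says that if a form of degree N attains its maximal modulus on the sphere at
    p, then every zero of the form on the sphere is at angle at least
    pi / (2 N) from p ([form_max_zero]).

    Embed R^d as the tangent hyperplane at the north pole of the sphere,
    homogenize P to degree n there, and multiply by k quadratic forms, the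
    j-th one vanishing on the parallels of latitude +- (2 j + 1) v.  The product
    has degree N = n + 2 k.  If v is slightly less than u := pi / (2 N), the
    parallels are so dense that a point at angle at least u from all of
    them has latitude more than 2 k v ([above_zone]), a bound that tends to
    pi / 2 - n u as v tends to u.  So a maximum point p of the product lies in a
    polar cap of angular radius about n u, while it is at angle at least u from
    the zeros of P.  The central projection maps the cap onto a ball of R^d and
    does not map p too close to the zeros ([gnomonic_dist]); scaling this ball
    to the unit ball gives a point of the unit ball at distance about
    sin u / tan (n u) from the zero set of P ([ball_point]).  As k tends to
    infinity u tends to 0, and sin (n u) <= n sin u shows that the distance
    tends to at least 1 / n ([ball_point_approx]).  Compactness of the ball
    concludes ([compact_limit_point]). *)

Set Implicit Arguments.
Unset Strict Implicit.
Unset Printing Implicit Defensive.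

Import Order.TTheory GRing.Theory Num.Theory numFieldNormedType.Exports.

Local Open Scope classical_set_scope.
Local Open Scope ring_scope.

(** * Polynomials with alternating signs *)

Lemma alternation_roots (R : rcfType) (p : {poly R}) (m : nat) (x : nat -> R) :
  (forall i, (i < m)%N -> x i.+1 < x i) ->
  (forall i, (i <= m)%N -> 0 < (-1) ^+ i * p.[x i]) ->
  exists s : seq R,
    [/\ size s = m, uniq s, all (root p) s & all (> x m) s].
Proof.
elim: m => [|m IHm] dec alt; first by exists [::].
have [||s [sz_s uniq_s root_s gt_s]] := IHm.
- by move=> i im; apply: dec; rewrite ltnS ltnW.
- by move=> i im; apply: alt; rewrite leqW.
have lt_x := dec m (ltnSn m).
have altS := alt m.+1 (leqnn _); have altm := alt m (leqnSn _).
have [r /andP[r1 r2] root_r] : exists2 r, x m.+1 <= r <= x m & root p r.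
  have [r r_in root_r] : exists2 r, x m.+1 <= r <= x m &
      root ((-1) ^+ m *: p) r.
    apply: poly_ivt; first exact: ltW.
    rewrite !hornerE (ltW altm) andbT.
    by move: altS; rewrite exprS mulN1r mulNr oppr_gt0 => /ltW.
  by exists r => //; rewrite rootZ ?signr_eq0 in root_r.
have [nz_m nz_mS] : p.[x m] != 0 /\ p.[x m.+1] != 0.
  by split; apply/eqP => p0; [move: altm|move: altS]; rewrite p0 mulr0 ltxx.
have gt_r : x m.+1 < r.
  by rewrite lt_neqAle r1 andbT; apply: contraNneq nz_mS => ->; exact: root_r.
have lt_r : r < x m.
  by rewrite lt_neqAle r2 andbT; apply: contraNneq nz_m => <-; exact: root_r.
exists (r :: s); split => /=.
- by rewrite sz_s.
- rewrite uniq_s andbT; apply/negP => /(allP gt_s) /= lt_xr.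
  by move: (lt_trans lt_xr lt_r); rewrite ltxx.
- by rewrite root_r.
- by rewrite gt_r; apply/allP => y /(allP gt_s) /=; apply: lt_trans.
Qed.

(** Each sign change costs a root, hence a degree.  The points are listed in
    decreasing order because they will be cotangents of increasing angles. *)
Lemma alternation_size (R : rcfType) (p : {poly R}) (m : nat) (x : nat -> R) :
  (forall i, (i < m)%N -> x i.+1 < x i) ->
  (forall i, (i <= m)%N -> 0 < (-1) ^+ i * p.[x i]) ->
  (m < size p)%N.
Proof.
move=> dec alt; have [s [<- uniq_s root_s _]] := alternation_roots dec alt.
apply: max_poly_roots => //; apply/eqP => p0.
by move: (alt 0%N isT); rewrite p0 horner0 mulr0 ltxx.
Qed.

(** * Trigonometric polynomials at a maximum *)

(** Real and imaginary parts of (cot t + i)^N = e^(i N t) / sin t ^ N. *)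
Lemma cos_sin_multiple (R : realType) (N : nat) :
  exists C S : {poly R}, [/\ (size C <= N.+1)%N, (size S <= N.+1)%N &
    forall t, sin t != 0 ->
      cos (N%:R * t) = sin t ^+ N * C.[cos t / sin t] /\
      sin (N%:R * t) = sin t ^+ N * S.[cos t / sin t]].
Proof.
elim: N => [|N [C [S [szC szS CS]]]].
  exists 1, 0; rewrite size_poly1 size_poly0; split => // t _.
  by rewrite mul0r cos0 sin0 !hornerE.
exists ('X * C - S), ('X * S + C); split.
- rewrite (leq_trans (size_polyD _ _)) // geq_max size_polyN.
  rewrite (leq_trans szS) // andbT; have [->|C0] := eqVneq C 0.
    by rewrite mulr0 size_poly0.
  by rewrite mulrC size_mulX.
- rewrite (leq_trans (size_polyD _ _)) // geq_max.
  rewrite (leq_trans szC) // andbT; have [->|S0] := eqVneq S 0.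
    by rewrite mulr0 size_poly0.
  by rewrite mulrC size_mulX.
move=> t st; have [cE sE] := CS t st.
rewrite -natr1 mulrDl mul1r cosD sinD cE sE !hornerE exprS.
by split; field.
Qed.

Lemma cot_decr (R : realType) (a b : R) :
  0 < a -> a < b -> b < pi -> cos b / sin b < cos a / sin a.
Proof.
move=> a0 ab bpi.
have sa : 0 < sin a by rewrite sin_gt0_pi // a0 (lt_trans ab).
have sb : 0 < sin b by rewrite sin_gt0_pi // bpi (lt_trans a0).
have : 0 < sin (b - a).
  by rewrite sin_gt0_pi // subr_gt0 ab /= (lt_trans _ bpi) // ltrBlDr ltrDl.
rewrite sinB ltr_pdivrMr // mulrAC ltr_pdivlMr //; nra.
Qed.

Lemma cos_natmul_pi (R : realType) (j : nat) :
  cos (j%:R * pi) = (-1) ^+ j :> R.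
Proof.
elim: j => [|j IHj]; first by rewrite mul0r cos0.
by rewrite -natr1 mulrDl mul1r cosDpi IHj exprS mulN1r.
Qed.

(** On the circle, a trigonometric polynomial which is the restriction of a
    binary form of degree N: in every rotated affine chart [cot] it is
    a univariate polynomial of degree at most N, up to the factor [sin t ^+ N].
    Asking for this in all charts lets the proofs choose where the circle is
    cut. *)
Definition circle_form (R : realType) (N : nat) (T : R -> R) :=
  forall s, exists2 h : {poly R}, (size h <= N.+1)%N &
    forall t, sin t != 0 -> T (s + t) = sin t ^+ N * h.[cos t / sin t].

(** Riesz's theorem.  Compare T with the shifted wave
    t |-> A cos (N (t + eta)), where A > 1 and A cos (N eta) < 1.  On the
    half-circle following - eta, the wave dominates |T| at its N extremal points,
    which forces N - 1 sign changes of the difference.  The first arc, where the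
    wave decreases from A to - A, contains in addition 0, where T = 1 exceeds the
    wave, and a supposed zero of T before the wave has changed sign.
    This gives N + 1 sign changes, too many for a form of degree N. *)
Lemma circle_form_max_no_zero (R : realType) (N : nat) (T : R -> R) :
  (0 < N)%N -> circle_form N T -> (forall t, `|T t| <= 1) -> T 0 = 1 ->
  forall t : R, 0 <= t -> t < pi / (N%:R *+ 2) -> T t != 0.
Proof.
move=> N0 formT leT T0 t0 t00 t0N; apply/eqP => Tt0.
have NR0 : 0 < N%:R :> R by rewrite ltr0n.
have pi0 := pi_gt0 R.
have t0lt : t0 * N%:R *+ 2 < pi.
  by rewrite -mulrnAr -ltr_pdivlMr // pmulrn_lgt0.
have t0gt : 0 < t0.
  rewrite lt_neqAle t00 andbT; apply/eqP => t0E.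
  by move: Tt0; rewrite -t0E T0 => /eqP; rewrite oner_eq0.
pose eta := (pi / (N%:R *+ 2) - t0) / 2.
have etaN : eta * N%:R = (pi - t0 * N%:R *+ 2) / 4.
  rewrite /eta; field; rewrite lt0r_neq0 //.
have eta0 : 0 < eta by rewrite divr_gt0 // subr_gt0.
have etaN0 : 0 < eta * N%:R by rewrite mulr_gt0.
have t0N0 : 0 < t0 * N%:R by rewrite mulr_gt0.
have cos1 : 0 < cos (N%:R * eta).
  by apply: cos_gt0_pihalf; lra.
have cos2 : cos (N%:R * eta) < cos (N%:R * (eta / 2)).
  rewrite ltr_cos; first by rewrite ltr_pM2l //; lra.
    by rewrite in_itv /=; apply/andP; split; lra.
  by rewrite in_itv /=; apply/andP; split; lra.
(* A is chosen between the inverses of the two cosines compared above. *)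
pose A := 2 / (cos (N%:R * eta) + cos (N%:R * (eta / 2))).
have A1 : 1 < A * cos (N%:R * (eta / 2)).
  rewrite /A mulrAC ltr_pdivlMr; lra.
have A2 : A * cos (N%:R * eta) < 1.
  rewrite /A mulrAC ltr_pdivrMr; lra.
have A3 : 1 < A.
  rewrite /A ltr_pdivlMr; last lra.
  have := cos_le1 (N%:R * (eta / 2)); lra.
have [h szh hT] := formT (- eta).
have [C [S [szC _ CS]]] := cos_sin_multiple R N.
pose D := A *: C - h.
have szD : (size D <= N.+1)%N.
  rewrite (leq_trans (size_polyD _ _)) // size_polyN geq_max szh andbT.
  by rewrite (leq_trans (size_scale_leq _ _)).
have DE t : sin t != 0 ->
    sin t ^+ N * D.[cos t / sin t] = A * cos (N%:R * t) - T (t - eta).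
  move=> st; rewrite (addrC t) hT // (CS t st).1.
  by rewrite /D hornerD hornerN hornerZ mulrBr mulrCA.
(* Alternation points, as angles measured from - eta.  The first one is eta / 2
   rather than 0, which is at infinity in the chart. *)
pose tau i : R := match i with
  | 0 => eta / 2 | 1 => eta | 2 => eta + t0
  | j.+2 => j%:R * (pi / N%:R) end.
have tauE j : (0 < j)%N -> tau j.+2 = j%:R * (pi / N%:R) by case: j.
have piN : 0 < pi / N%:R :> R by rewrite divr_gt0.
have tau2 : (eta + t0) * N%:R *+ 2 < pi by rewrite mulrDl etaN; lra.
have tauS i : tau i < tau i.+1.
  case: i => [|[|[|i]]].
  - rewrite /=; lra.
  - rewrite /=; lra.
  - rewrite (tauE 1%N) // mul1r /= ltr_pdivlMr //; move: tau2.
    rewrite -mulr_natr; lra.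
  - by rewrite !tauE // ltr_pM2r // ltr_nat.
have tau0 i : 0 < tau i.
  by elim: i => [|i IHi] /=; [lra|apply: lt_trans (tauS i)].
have taupi i : (i <= N.+1)%N -> tau i < pi.
  move=> iN; have tau_le : tau i <= tau N.+1.
    apply: (homo_leq (r := fun x y : R => x <= y)) iN => // [x y z|j].
      exact: le_trans.
    exact: ltW.
  have N1 : tau N.+1 < pi.
    have [N1|N1] := leqP N 1.
      have -> : N.+1 = 2%N by apply/eqP; rewrite eqSS eqn_leq N1.
      have := tau2; have N1E : N = 1%N by apply/eqP; rewrite eqn_leq N1.
      rewrite [in N%:R]N1E mulr1 -mulr_natr /=; lra.
    have -> : N.+1 = N.-1.+2 by rewrite prednK.
    rewrite tauE ?ltn_predRL // mulrA ltr_pdivrMr // mulrC ltr_pM2l //.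
    by rewrite ltr_nat prednK.
  exact: le_lt_trans N1.
have sin_tau i : (i <= N.+1)%N -> 0 < sin (tau i).
  by move=> iN; rewrite sin_gt0_pi // tau0 taupi.
have : (N.+1 < size D)%N; last by rewrite ltnNge szD.
apply: (@alternation_size _ _ _ (fun i => cos (tau i) / sin (tau i))).
  by move=> i iN; apply: cot_decr => //; apply: taupi.
move=> i iN; have s0 := sin_tau i iN.
rewrite -(pmulr_rgt0 _ (exprn_gt0 N s0)) mulrCA DE ?lt0r_neq0 //.
case: i {s0 iN} => [|[|[|i]]].
- have := leT (eta / 2 - eta); rewrite ler_norml /= mul1r; lra.
- rewrite /= expr1 subrr T0; lra.
- rewrite /= expr2 mulrNN !mul1r addrAC subrr add0r Tt0 subr0.
  rewrite mulr_gt0 //; first lra.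
  by apply: cos_gt0_pihalf; rewrite mulrC; lra.
have := leT (tau i.+3 - eta); rewrite ler_norml tauE //.
have -> : N%:R * (i.+1%:R * (pi / N%:R)) = i.+1%:R * pi :> R.
  by field; rewrite lt0r_neq0.
rewrite cos_natmul_pi !exprS -(signr_odd _ i).
by case: (odd i); rewrite ?(expr0, expr1) => /andP[l1 l2]; lra.
Qed.

(** * Forms on the unit sphere *)

Lemma poly_nonroot (R : numDomainType) (p : {poly R}) :
  p != 0 -> exists x, p.[x] != 0.
Proof.
move=> p0; pose s := [seq i%:R : R | i <- iota 0 (size p)].
have /allPn[x _ px] : ~~ all (root p) s; last by exists x.
apply/negP => root_s; have := max_poly_roots p0 root_s.
rewrite size_map size_iota ltnn => uniq_s; suff: false by [].
by apply: uniq_s; rewrite map_inj_uniq ?iota_uniq //; apply: mulrIn (oner_neq0 R).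
Qed.

Definition dot (R : realType) (m : nat) (u v : 'rV[R]_m) : R :=
  \sum_i u ord0 i * v ord0 i.

Section Dot.
Context {R : realType} {m : nat}.
Implicit Types u v w : 'rV[R]_m.

Lemma dotC u v : dot u v = dot v u.
Proof. by apply: eq_bigr => i _; rewrite mulrC. Qed.

Lemma dotDl u v w : dot (u + v) w = dot u w + dot v w.
Proof. by rewrite -big_split; apply: eq_bigr => i _; rewrite mxE mulrDl. Qed.

Lemma dotZl a u v : dot (a *: u) v = a * dot u v.
Proof. by rewrite mulr_sumr; apply: eq_bigr => i _; rewrite mxE mulrA. Qed.

Lemma dotDr u v w : dot u (v + w) = dot u v + dot u w.
Proof. by rewrite dotC dotDl !(dotC u). Qed.

Lemma dotZr a u v : dot u (a *: v) = a * dot u v.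
Proof. by rewrite dotC dotZl dotC. Qed.

Lemma dotNl u v : dot (- u) v = - dot u v.
Proof. by rewrite -scaleN1r dotZl mulN1r. Qed.

Lemma dotNr u v : dot u (- v) = - dot u v.
Proof. by rewrite dotC dotNl dotC. Qed.

Definition dotE := (dotDl, dotDr, dotNl, dotNr, dotZl, dotZr).

Lemma dot_ge0 u : 0 <= dot u u.
Proof. by apply: sumr_ge0 => i _; rewrite -expr2 sqr_ge0. Qed.

Lemma dot_eq0 u : dot u u = 0 -> u = 0.
Proof.
move/psumr_eq0P => u0; apply/rowP => i; rewrite mxE.
by apply/eqP; rewrite -sqrf_eq0 expr2 u0 // => j _; rewrite -expr2 sqr_ge0.
Qed.

Lemma enormE u : enorm u = Num.sqrt (dot u u).
Proof. by []. Qed.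

Lemma continuous_dot : continuous (fun u => dot u u).
Proof.
apply: continuous_big => [|i _ u]; first exact: add_continuous.
by have cu := @coord_continuous R 1 m ord0 i u; exact: (cvgM cu cu).
Qed.

Lemma compact_dot r : compact [set u : 'rV[R]_m | dot u u <= r].
Proof.
apply: bounded_closed_compact.
  exists (Num.sqrt r); split; first exact: num_real.
  move=> M rM u /= ur; rewrite [leLHS]/Num.norm /= mx_normrE.
  apply/bigmax_leP; split => /=.
    exact: le_trans (sqrtr_ge0 r) (ltW rM).
  move=> [i j] _ /=; rewrite (ord1 i); apply: le_trans (ltW rM).
  rewrite -sqrtr_sqr ler_sqrt; last by rewrite (le_trans _ ur) ?dot_ge0.
  apply: le_trans ur; rewrite /dot (bigD1 j) //= expr2 lerDl.
  by apply: sumr_ge0 => k _; rewrite -expr2 sqr_ge0.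
apply: (@closed_comp _ _ (fun u => dot u u) [set x | x <= r]).
  by move=> u _; apply: continuous_dot.
exact: closed_le.
Qed.

Lemma compact_sphere : compact [set u : 'rV[R]_m | dot u u = 1].
Proof.
have cl : closed [set u : 'rV[R]_m | dot u u = 1].
  apply: (@closed_comp _ _ (fun u => dot u u) [set x | x = 1]).
    by move=> u _; apply: continuous_dot.
  exact: closed_eq.
by apply: (subclosed_compact cl (@compact_dot 1)) => u /= ->.
Qed.

End Dot.

(** Homogeneous polynomials of degree N in m variables, through the three
    properties that matter here.  Being polynomial is only required along lines,
    which makes closure under sums and products immediate. *)
Definition form (R : realType) (m N : nat) (Q : 'rV[R]_m -> R) :=
  [/\ continuous Q,
      forall c z, Q (c *: z) = c ^+ N * Q z
    & forall a b, exists2 h : {poly R},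
        (size h <= N.+1)%N & forall x, Q (a + x *: b) = h.[x]].

Section Form.
Context {R : realType} {m : nat}.
Implicit Types F G Q : 'rV[R]_m -> R.

Lemma form_const c : form 0 (fun _ : 'rV[R]_m => c).
Proof.
split=> [z|a z|a b]; [exact: cst_continuous|by rewrite expr0 mul1r|].
by exists c%:P => [|x]; [rewrite size_polyC leq_b1|rewrite hornerE].
Qed.

Lemma form_coord i : form 1 (fun z : 'rV[R]_m => z ord0 i).
Proof.
split=> [z|c z|a b]; [exact: (@coord_continuous R 1 m)|by rewrite mxE|].
exists ((a ord0 i)%:P + b ord0 i *: 'X) => [|x].
  2: by rewrite !(mxE, hornerE) mulrC.
rewrite (leq_trans (size_polyD _ _)) // geq_max.
rewrite (leq_trans (size_scale_leq _ _)) ?size_polyX // andbT size_polyC.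
exact: leq_trans (leq_b1 _) _.
Qed.

Lemma form_mul M N F G : form M F -> form N G ->
  form (M + N) (fun z => F z * G z).
Proof.
move=> [cF hF lF] [cG hG lG]; split=> [z|c z|a b].
- exact: (cvgM (cF z) (cG z)).
- by rewrite hF hG exprD; ring.
have [f szf fE] := lF a b; have [g szg gE] := lG a b.
exists (f * g) => [|x]; last by rewrite hornerM fE gE.
rewrite (leq_trans (size_polyMleq _ _)) // -subn1 leq_subLR add1n.
by rewrite (leq_trans (leq_add szf szg)) // addSn addnS.
Qed.

Lemma form_exp F e : form 1 F -> form e (fun z => F z ^+ e).
Proof.
move=> formF; elim: e => [|e IHe]; first exact: form_const.
rewrite (_ : (fun z => _) = fun z => F z * F z ^+ e).
  exact: form_mul formF IHe.
by apply/funext => z; rewrite exprS.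
Qed.

Lemma form_prod (I : Type) (r : seq I) (N : I -> nat) (F : I -> 'rV[R]_m -> R) :
  (forall i, form (N i) (F i)) ->
  form (\sum_(i <- r) N i) (fun z => \prod_(i <- r) F i z).
Proof.
move=> formF; elim: r => [|i r IHr].
  rewrite big_nil (_ : (fun z => _) = fun=> 1); first exact: form_const.
  by apply/funext => z; rewrite big_nil.
rewrite big_cons (_ : (fun z => _) = fun z => F i z * \prod_(j <- r) F j z).
  exact: form_mul.
by apply/funext => z; rewrite big_cons.
Qed.

Lemma form_scale c N F : form N F -> form N (fun z => c * F z).
Proof. by move=> formF; apply: (form_mul (form_const c) formF). Qed.

Lemma form_add N F G : form N F -> form N G -> form N (fun z => F z + G z).
Proof.
move=> [cF hF lF] [cG hG lG]; split=> [z|c z|a b].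
- exact: (cvgD (cF z) (cG z)).
- by rewrite hF hG mulrDr.
have [f szf fE] := lF a b; have [g szg gE] := lG a b.
exists (f + g) => [|x]; last by rewrite hornerD fE gE.
by rewrite (leq_trans (size_polyD _ _)) // geq_max szf.
Qed.

Lemma form_sum (I : eqType) (r : seq I) N (F : I -> 'rV[R]_m -> R) :
  (forall i, i \in r -> form N (F i)) -> form N (fun z => \sum_(i <- r) F i z).
Proof.
elim: r => [|i r IHr] formF.
  rewrite (_ : (fun z => _) = fun=> 0).
    split=> [z|c z|a b]; [exact: cst_continuous|by rewrite mulr0|].
    by exists 0 => [|x]; rewrite ?size_poly0 ?horner0.
  by apply/funext => z; rewrite big_nil.
rewrite (_ : (fun z => _) = fun z => F i z + \sum_(j <- r) F j z).
  apply: form_add; first by apply: formF; rewrite mem_head.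
  by apply: IHr => j jr; apply: formF; rewrite inE jr orbT.
by apply/funext => z; rewrite big_cons.
Qed.

(** The form F * G is nonzero on the line through a and b, where it is a product
    of two nonzero univariate polynomials. *)
Lemma form_mul_neq0 M N F G a b : form M F -> form N G ->
  F a != 0 -> G b != 0 -> exists z, F z * G z != 0.
Proof.
move=> [_ _ lF] [_ _ lG] Fa Gb.
have [f _ fE] := lF a (b - a); have [g _ gE] := lG a (b - a).
have f0 : f != 0.
  by apply: contraNneq Fa => f0; rewrite -[a]addr0 -(scale0r (b - a)) fE f0 horner0.
have g0 : g != 0.
  apply: contraNneq Gb => g0.
  by rewrite -[b](subrK a) addrC -[b - a]scale1r gE g0 horner0.
have fg0 : f * g != 0 by rewrite mulf_neq0.
have [x fgx] := poly_nonroot fg0.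
by exists (a + x *: (b - a)); rewrite fE gE -hornerM.
Qed.

Lemma form_circle N Q p q : form N Q ->
  circle_form N (fun t => Q (cos t *: p + sin t *: q)).
Proof.
move=> [_ hQ lQ] s.
have [h szh hE] := lQ (cos s *: q - sin s *: p) (cos s *: p + sin s *: q).
exists h => // t st; rewrite -hE -hQ; congr Q.
rewrite cosD sinD; apply/rowP => i; rewrite !mxE; field.
exact: st.
Qed.

(** Riesz's theorem on the great circle through p and w; the angle between them
    is acos (dot p w). *)
Lemma form_max_zero N Q p w : (0 < N)%N -> form N Q ->
  dot p p = 1 -> dot w w = 1 ->
  (forall z, dot z z = 1 -> `|Q z| <= `|Q p|) -> Q p != 0 -> Q w = 0 ->
  dot p w <= cos (pi / (N%:R *+ 2)).
Proof.
move=> N0 formQ pp ww maxp Qp Qw; rewrite leNgt; apply/negP => u_lt.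
set u := pi / _ in u_lt; set c := dot p w in u_lt.
have NR : 1 <= N%:R :> R by rewrite ler1n.
have pi0 := pi_gt0 R.
have u_in : 0 <= u <= pi.
  apply/andP; split; first by rewrite divr_ge0 ?pi_ge0 ?mulrn_wge0 ?ler0n.
  by rewrite ler_pdivrMr -mulr_natr; nra.
have dpw : dot (w - p) (w - p) = 2 - 2 * c.
  by rewrite !dotE (dotC w p) pp ww /c; ring.
have dpw' : dot (w + p) (w + p) = 2 + 2 * c.
  by rewrite !dotE (dotC w p) pp ww /c; ring.
have c1 : c < 1.
  have := dot_ge0 (w - p); rewrite dpw => c1.
  rewrite lt_neqAle; apply/andP; split; last lra.
  apply: contraNneq Qp => cE; suff -> : p = w by rewrite Qw.
  by apply/esym/eqP; rewrite -subr_eq0; apply/eqP/dot_eq0; rewrite dpw cE; ring.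
have c2 : -1 <= c by have := dot_ge0 (w + p); rewrite dpw'; lra.
have c12 : -1 <= c <= 1 by rewrite c2 ltW.
have [/andP[t00 t0pi] cosE] := acos_def c12.
set t0 := acos c in t00 t0pi cosE.
have sin2 : sin t0 ^+ 2 = 1 - c ^+ 2 by rewrite sin2cos2 cosE.
have sin_n0 : sin t0 != 0.
  rewrite -sqrf_eq0 sin2 subr_eq0 eq_sym sqrf_eq1 negb_or; apply/andP; split.
    by rewrite lt_eqF.
  rewrite gt_eqF //; apply: le_lt_trans u_lt; exact: cos_geN1.
have [q [pq qq wE]] : exists q,
    [/\ dot p q = 0, dot q q = 1 & w = c *: p + sin t0 *: q].
  exists ((sin t0)^-1 *: (w - c *: p)); split.
  - by rewrite !dotE pp -/c; ring.
  - have dq : dot (w - c *: p) (w - c *: p) = sin t0 ^+ 2.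
      by rewrite sin2 !dotE pp ww (dotC w p) -/c; ring.
    by rewrite dotZl dotZr dq; field.
  - by rewrite scalerA mulfV // scale1r addrC subrK.
pose T t := (Q p)^-1 * Q (cos t *: p + sin t *: q).
have : T t0 != 0.
  apply: (@circle_form_max_no_zero _ N T) => //.
  - exact: (form_circle p q (form_scale (Q p)^-1 formQ)).
  - move=> t; rewrite normrM normfV mulrC ler_pdivrMr ?normr_gt0 // mul1r.
    apply: maxp; rewrite !dotE pp qq (dotC q p) pq.
    by rewrite !(mulr0, mulr1, addr0, add0r) -!expr2 cos2Dsin2.
  - by rewrite /T cos0 sin0 scale1r scale0r addr0 mulVf.
  - rewrite -(@ltr_cos R) ?in_itv /= ?t00 ?t0pi ?u_in //.
    by rewrite cosE.
by rewrite /T cosE -wE Qw mulr0 eqxx.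
Qed.

End Form.

(** * Homogenization and parallels *)

Lemma digits_inj (B n : nat) (a b : 'I_n -> nat) :
  (forall i, (a i < B)%N) -> (forall i, (b i < B)%N) ->
  (\sum_i a i * B ^ i = \sum_i b i * B ^ i)%N -> a =1 b.
Proof.
elim: n a b => [|n IHn] a b aB bB; first by move=> _ [].
have B0 : (0 < B)%N by apply: leq_ltn_trans (aB ord0).
have tailE (f : 'I_n.+1 -> nat) : (\sum_i f i * B ^ i =
    (\sum_(i < n) f (lift ord0 i) * B ^ i) * B + f ord0)%N.
  rewrite big_ord_recl expn0 muln1 addnC big_distrl; congr (_ + _)%N.
  by apply: eq_bigr => i _; rewrite /= /bump /= add1n expnSr mulnA.
rewrite !tailE => E.
have E0 : a ord0 = b ord0.
  by have := congr1 (modn^~ B) E; rewrite /= !modnMDl !modn_small.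
move: E; rewrite E0 => /addIn /eqP; rewrite eqn_pmul2r // => /eqP E i.
by case: (unliftP ord0 i) => [j|] -> //; apply: (IHn _ _ _ _ E j).
Qed.

(** Kronecker substitution: putting x_i = t ^ (B ^ i) with B larger than all
    exponents sends distinct monomials to distinct powers of t, so P becomes a
    nonzero univariate polynomial. *)
Lemma mpoly_nonzero_point (R : numDomainType) (n : nat) (P : {mpoly R[n]}) :
  P != 0 -> exists x : 'I_n -> R, P.@[x] != 0.
Proof.
move=> P0; pose B := msize P.
pose e (m : 'X_{1..n}) := (\sum_i m i * B ^ i)%N.
pose q : {poly R} := \sum_(m <- msupp P) P@_m *: 'X^(e m).
have digit m : m \in msupp P -> forall i, (m i < B)%N.
  move=> /msize_mdeg_lt mP i; apply: leq_ltn_trans mP.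
  by rewrite mdegE (bigD1 i) //= leq_addr.
have q0 : q != 0.
  have m0P := mlead_supp P0; set m0 := mlead P in m0P.
  apply/eqP => q0; have : q`_(e m0) = P@_m0.
    rewrite coef_sum (bigD1_seq m0) //= coefZ coefXn eqxx mulr1.
    rewrite big1_seq ?addr0 // => m /andP[m_m0 mP].
    rewrite coefZ coefXn; case: eqP => [E|]; last by rewrite mulr0.
    case/eqP: m_m0; apply/mnmP; apply: (digits_inj (digit m mP)) (esym E).
    exact: digit.
  by rewrite q0 coef0 => /esym/eqP; rewrite mcoeff_eq0 m0P.
have [t qt] := poly_nonroot q0; exists (fun i => t ^+ (B ^ i)).
suff -> : P.@[fun i => t ^+ (B ^ i)] = q.[t] by [].
rewrite mevalE horner_sum; apply: eq_bigr => m _.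
rewrite hornerZ hornerXn /e expr_sum; congr (_ * _); apply: eq_bigr => i _.
by rewrite -exprM mulnC.
Qed.

Definition vcons (R : realType) (d : nat) (s : R) (y : 'rV[R]_d) : 'rV[R]_d.+1 :=
  \row_i (if unlift ord0 i is Some j then y ord0 j else s).

Section Vcons.
Context {R : realType} {d : nat}.
Implicit Types (s : R) (y : 'rV[R]_d).

Lemma vcons0 s y : vcons s y ord0 ord0 = s.
Proof. by rewrite mxE unlift_none. Qed.

Lemma vconsS s y i : vcons s y ord0 (lift ord0 i) = y ord0 i.
Proof. by rewrite mxE liftK. Qed.

Lemma vconsP (z : 'rV[R]_d.+1) : exists s y, z = vcons s y.
Proof.
exists (z ord0 ord0), (\row_i z ord0 (lift ord0 i)); apply/rowP => i.
by case: (unliftP ord0 i) => [j|] ->; rewrite ?vcons0 // vconsS mxE.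
Qed.

Lemma scale_vcons a s y : a *: vcons s y = vcons (a * s) (a *: y).
Proof.
by apply/rowP => i; rewrite !mxE; case: unlift => [j|] //; rewrite mxE.
Qed.

Lemma dot_vcons s y s' y' :
  dot (vcons s y) (vcons s' y') = s * s' + dot y y'.
Proof.
rewrite /dot big_ord_recl !vcons0; congr (_ + _).
by apply: eq_bigr => i _; rewrite !vconsS.
Qed.

(** The homogenization of c ^ n * P(y / c): the factor c scales R^d, so that the
    ball which the central projection produces becomes the unit ball. *)
Definition homogenization (c : R) (n : nat) (P : {mpoly R[d]})
    (z : 'rV[R]_d.+1) : R :=
  \sum_(m <- msupp P) P@_m *
    ((c * z ord0 ord0) ^+ (n - mdeg m) *
     \prod_i z ord0 (lift ord0 i) ^+ m i).

Lemma homogenizationE c n (P : {mpoly R[d]}) s x :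
  (msize P <= n.+1)%N ->
  homogenization c n P (vcons s ((c * s) *: x)) =
  (c * s) ^+ n * P.@[fun i => x ord0 i].
Proof.
move=> szP; rewrite mevalE mulr_sumr; apply: eq_big_seq => m mP.
rewrite [RHS]mulrCA vcons0; congr (_ * _).
have mn : (mdeg m <= n)%N by rewrite -ltnS (leq_trans (msize_mdeg_lt mP)).
have -> : (c * s) ^+ n = (c * s) ^+ (n - mdeg m) * (c * s) ^+ mdeg m.
  by rewrite -exprD subnK.
rewrite -mulrA; congr (_ * _).
rewrite mdegE expr_sum -big_split; apply: eq_bigr => i _.
by rewrite vconsS mxE exprMn.
Qed.

Lemma form_homogenization c n (P : {mpoly R[d]}) :
  (msize P <= n.+1)%N -> form n (homogenization c n P).
Proof.
move=> szP; apply: form_sum => m mP; apply: form_scale.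
have mn : (mdeg m <= n)%N by rewrite -ltnS (leq_trans (msize_mdeg_lt mP)).
have nE : (n - mdeg m + \sum_i m i = n)%N by rewrite -mdegE subnK.
rewrite -[X in form X]nE; apply: form_mul.
  by apply: form_exp; apply: form_scale; apply: form_coord.
by apply: form_prod => i; apply: form_exp; apply: form_coord.
Qed.

(** On the unit sphere, where the first coordinate is the sine of the latitude,
    this quadratic form vanishes exactly at the latitudes a and - a. *)
Definition latitude_form (a : R) (z : 'rV[R]_d.+1) : R :=
  cos a ^+ 2 * z ord0 ord0 ^+ 2 -
  sin a ^+ 2 * \sum_i z ord0 (lift ord0 i) ^+ 2.

Lemma latitude_formE a s y :
  latitude_form a (vcons s y) = cos a ^+ 2 * s ^+ 2 - sin a ^+ 2 * dot y y.
Proof.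
rewrite /latitude_form vcons0; congr (_ - _ * _).
by apply: eq_bigr => i _; rewrite vconsS expr2.
Qed.

Lemma form_latitude a : form 2 (latitude_form a).
Proof.
apply: form_add; first by apply: form_scale; apply/form_exp/form_coord.
rewrite (_ : (fun z => _) = fun z : 'rV[R]_d.+1 => - sin a ^+ 2 *
  \sum_i z ord0 (lift ord0 i) ^+ 2); last by apply/funext => z; rewrite mulNr.
by apply: form_scale; apply: form_sum => i _; apply/form_exp/form_coord.
Qed.

End Vcons.

(** The intervals of radius v around v, 3 v, ..., (2 k - 1) v tile
    [0, 2 k v]. *)
Lemma zone_covered (R : realFieldType) (v l : R) (k : nat) :
  (0 < k)%N -> 0 <= l -> l <= (k.*2)%:R * v ->
  exists2 j, (j < k)%N & `|l - (j.*2.+1)%:R * v| <= v.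
Proof.
move=> + l0; elim: k => // k IHk _ lk.
have [lk'|] := lerP l ((k.*2)%:R * v).
  case: k IHk lk lk' => [|k] IHk lk lk'.
    exists 0%N => //; rewrite ler_norml mul1r.
    by move: lk; rewrite -[_%:R]/2%:R; lra.
  by have [//|j jk lj] := IHk _ lk'; exists j; rewrite // ltnW.
move=> gtl; exists k => //; rewrite ler_norml.
move: lk gtl; rewrite doubleS -!natr1; lra.
Qed.

(** * The maximum point and its projection *)

Lemma form_max_exists (R : realType) (m N : nat) (Q : 'rV[R]_m -> R) z0 :
  (0 < N)%N -> form N Q -> Q z0 != 0 ->
  exists p, [/\ dot p p = 1, Q p != 0 &
    forall z, dot z z = 1 -> `|Q z| <= `|Q p|].
Proof.
move=> N0 [cQ hQ _] Qz0; set r := dot z0 z0.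
have r0 : 0 < r.
  rewrite lt_neqAle dot_ge0 andbT eq_sym; apply: contraNneq Qz0 => /dot_eq0 ->.
  by rewrite -(scale0r 0) hQ expr0n gtn_eqF // mul0r.
pose e := (Num.sqrt r)^-1 *: z0.
have ee : dot e e = 1.
  by rewrite dotZl dotZr mulrA -expr2 exprVn sqr_sqrtr ?ltW // mulVf ?gt_eqF.
have Qe : Q e != 0.
  by rewrite hQ mulf_neq0 // expf_neq0 // invr_neq0 // gt_eqF ?sqrtr_gt0.
have contQ : {within [set u | dot u u = 1], continuous (fun z => `|Q z|)}.
  apply: continuous_subspaceT => z; exact: (cvg_norm (cQ z)).
have [||p p1 maxp] := compact_EVT_max _ _ contQ; first by exists e.
  exact: compact_sphere.
have max' z : dot z z = 1 -> `|Q z| <= `|Q p|.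
  by move=> z1; apply: maxp; rewrite inE.
exists p; split => //; first by rewrite inE in p1.
by rewrite -normr_gt0; apply: lt_le_trans (max' e ee); rewrite normr_gt0.
Qed.


(** A point of latitude at most 2 k v is within v of one of the latitudes
    (2 j + 1) v; moving along its meridian reaches a zero of that form after an
    angle at most v, against the assumption that zeros are at angle at least
    u > v. *)
Lemma above_zone (R : realType) (d k : nat) (v u s : R) (y : 'rV[R]_d) :
  (0 < k)%N -> 0 < v -> v < u -> u <= pi -> (k.*2)%:R * v < pi / 2 ->
  0 <= s -> s ^+ 2 + dot y y = 1 ->
  (forall j w, (j < k)%N -> dot w w = 1 ->
    latitude_form ((j.*2.+1)%:R * v) w = 0 -> dot (vcons s y) w <= cos u) ->
  sin ((k.*2)%:R * v) < s.
Proof.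
move=> k0 v0 vu upi; set L := _ * v => Lpi s0 pp zero_far.
have pi0 := pi_gt0 R.
have L0 : 0 < L by rewrite mulr_gt0 // ltr0n double_gt0.
have s1 : -1 <= s <= 1.
  by have := dot_ge0 y => y0; apply/andP; split; nra.
rewrite ltNge; apply/negP => sleL.
have [/andP[l1 l2] sinl] := asin_def s1; set l := asin s in l1 l2 sinl.
have l0 : 0 <= l.
  rewrite leNgt; apply/negP => lneg.
  have : sin l < sin 0 by rewrite ltr_sin ?in_itv /=; lra.
  by rewrite sin0 sinl ltNge s0.
have lL : l <= L.
  rewrite leNgt; apply/negP => Ll.
  have : sin L < sin l by rewrite ltr_sin ?in_itv /=; lra.
  by rewrite sinl ltNge sleL.
have [j jk lj] := zone_covered k0 l0 lL; set al := _ * v in lj.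
have al0 : 0 < al by rewrite mulr_gt0.
have alpi : al < pi / 2.
  by apply: le_lt_trans Lpi; rewrite ler_pM2r // ler_nat ltn_double.
have cl : 0 < cos l by rewrite cos_gt0_pihalf //; lra.
have yy : dot y y = cos l ^+ 2 by rewrite cos2sin2 sinl; lra.
(* The point of latitude [al] on the meridian through [vcons s y]. *)
pose w := vcons (sin al) ((cos al / cos l) *: y).
have ww : dot w w = 1.
  rewrite dot_vcons dotZl dotZr yy -(cos2Dsin2 al); field.
  by rewrite gt_eqF.
have cw : latitude_form al w = 0.
  by rewrite latitude_formE dotZl dotZr yy; field; rewrite gt_eqF.
have := zero_far j w jk ww cw; rewrite dot_vcons dotZr yy -sinl.
have -> : sin l * sin al + cos al / cos l * cos l ^+ 2 = cos (l - al).
  by rewrite cosB; field; rewrite gt_eqF.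
rewrite -cos_norm leNgt => /negP; apply.
by rewrite ltr_cos ?in_itv /=; have := normr_ge0 (l - al); lra.
Qed.

(** Central projection onto the tangent hyperplane at the pole: (s, y) goes to
    s^-1 *: y, and the last hypothesis says that (s, y) is at angle at least u
    from the direction of (1, b).  The projected point is at distance at least 1
    from the centre of the sphere, hence at least sin u from that ray. *)
Lemma gnomonic_dist (R : realType) (d : nat) (s u : R) (y b : 'rV[R]_d) :
  0 < s -> s ^+ 2 + dot y y = 1 ->
  s + dot y b <= Num.sqrt (1 + dot b b) * cos u ->
  sin u ^+ 2 <= dot (s^-1 *: y - b) (s^-1 *: y - b).
Proof.
move=> sp pp; set B := Num.sqrt _ => far.
have BB : B ^+ 2 = 1 + dot b b.
  by rewrite sqr_sqrtr // addr_ge0 ?ler01 ?dot_ge0.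
have ss : 0 < s ^+ 2 by rewrite exprn_gt0.
have ss1 : 0 <= 1 - s ^+ 2 by have := dot_ge0 y; lra.
have [a yE] : exists a, y = s *: a.
  by exists (s^-1 *: y); rewrite scalerA mulfV ?scale1r // gt_eqF.
have -> : s^-1 *: y = a by rewrite yE scalerA mulVf ?scale1r // gt_eqF.
have aa : s ^+ 2 * (1 + dot a a) = 1.
  have -> : s ^+ 2 * (1 + dot a a) = s ^+ 2 + dot (s *: a) (s *: a).
    by rewrite dotZl dotZr; ring.
  by rewrite -yE.
have ab : s * (s * (1 + dot a b)) <= s * (B * cos u).
  by rewrite ler_pM2l //; move: far; rewrite yE dotZl; lra.
rewrite !dotE (dotC b a) sin2cos2.
have CC : 0 <= 1 - cos u ^+ 2 by rewrite -sin2cos2 sqr_ge0.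
(* By the law of cosines, s ^ 2 times the squared distance is at least
   1 - 2 s B cos u + (s B) ^ 2 = (s B - cos u) ^ 2 + sin u ^ 2. *)
rewrite -(ler_pM2l ss).
have := mulr_ge0 CC ss1; have := sqr_ge0 (s * B - cos u).
have := congr1 (fun x => s ^+ 2 * x) BB; move: aa ab; rewrite /=.
lra.
Qed.

(** With L the lower bound on the latitude of the maximum point, its central
    projection lies in the ball of radius c = cot L, which is scaled to the unit
    ball.  The conclusion is a squared distance, cleared of denominators. *)
Lemma ball_point (R : realType) (d n k : nat) (P : {mpoly R[d]}) (v : R) :
  P != 0 -> (msize P <= n.+1)%N -> (0 < n)%N -> (0 < k)%N -> 0 < v ->
  v < pi / ((n + k.*2)%:R *+ 2) ->
  exists2 x : 'rV[R]_d, dot x x <= 1 &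
    forall z : 'rV[R]_d, P.@[fun i => z ord0 i] = 0 ->
      sin (pi / ((n + k.*2)%:R *+ 2)) ^+ 2 * sin ((k.*2)%:R * v) ^+ 2 <=
      cos ((k.*2)%:R * v) ^+ 2 * dot (x - z) (x - z).
Proof.
move=> P0 szP n0 k0 v0; set u := pi / _ => vu; set L := _ * v.
pose N := (n + k.*2)%N; have N0 : (0 < N)%N by rewrite addn_gt0 n0.
have pi0 := pi_gt0 R.
have k2 : 0 < (k.*2)%:R :> R by rewrite ltr0n double_gt0.
have NE : (k.*2)%:R + 1 <= N%:R :> R by rewrite natr1 ler_nat /N -add1n leq_add2r.
have uN : u * N%:R = pi / 2.
  have : N%:R != 0 :> R by rewrite pnatr_eq0 -lt0n.
  by move=> NR0; rewrite /u -mulr_natr invfM mulrA mulrAC divfK.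
have u0 : 0 < u by apply: lt_trans vu.
have L0 : 0 < L by rewrite mulr_gt0.
have Lpi : L < pi / 2 by rewrite -uN /L; nra.
have upi : u <= pi / 2 by rewrite -uN; nra.
have sL : 0 < sin L by rewrite sin_gt0_pihalf // L0.
have cL : 0 < cos L by rewrite cos_gt0_pihalf // Lpi andbT; lra.
pose c := cos L / sin L; have c0 : 0 < c by rewrite divr_gt0.
pose al j : R := (j.*2.+1)%:R * v.
have alL j : (j < k)%N -> 0 < al j < pi / 2.
  move=> jk; rewrite mulr_gt0 //=; apply: le_lt_trans Lpi.
  by rewrite ler_pM2r // ler_nat ltn_double.
pose Q z := homogenization c n P z * \prod_(j <- iota 0 k) latitude_form (al j) z.
have formC : form (k.*2) (fun z : 'rV[R]_d.+1 =>
    \prod_(j <- iota 0 k) latitude_form (al j) z).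
  have := form_prod (iota 0 k) (fun j => form_latitude (d := d) (al j)).
  by rewrite big_const_seq count_predT size_iota iter_addn_0 mul2n.
have formH := form_homogenization c szP.
have formQ : form N Q := form_mul formH formC.
have [z0 Qz0] : exists z0, Q z0 != 0.
  have [x Px] := mpoly_nonzero_point P0.
  apply: (@form_mul_neq0 _ _ _ _ _ _ (vcons 1 ((c * 1) *: (\row_i x i)))
            (vcons 1 0) formH formC).
    rewrite homogenizationE // mulf_neq0 //.
      by rewrite mulr1 expf_neq0 // gt_eqF.
    by rewrite (meval_eq (v2 := x)) // => i; rewrite mxE.
  rewrite prodf_seq_neq0; apply/allP => j; rewrite mem_iota add0n /= => jk.
  rewrite latitude_formE /dot big1 ?mulr0 ?subr0 => [|i _]; last by rewrite mxE mul0r.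
  rewrite expr1n mulr1 expf_neq0 // gt_eqF // cos_gt0_pihalf //.
  by have /andP[a0 ->] := alL _ jk; rewrite andbT; lra.
(* A maximum point in the northern hemisphere, by symmetry. *)
have [p0 [p01 Qp0 max0]] := form_max_exists N0 formQ Qz0.
have [p [pp Qp maxp s0]] : exists p, [/\ dot p p = 1, Q p != 0,
    forall z, dot z z = 1 -> `|Q z| <= `|Q p| & 0 <= p ord0 ord0].
  have [s0|s0] := lerP 0 (p0 ord0 ord0); first by exists p0.
  have QN : Q (- p0) = (-1) ^+ N * Q p0.
    by have [_ hQ _] := formQ; rewrite -scaleN1r hQ.
  exists (- p0); split; first by rewrite !dotE opprK.
  - by rewrite QN mulf_neq0 // signr_eq0.
  - by rewrite QN normrM normrX normrN1 expr1n mul1r.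
  - by rewrite mxE oppr_ge0 ltW.
have zero_far := form_max_zero N0 formQ pp _ maxp Qp.
rewrite -/u in zero_far.
have [s [y pE]] := vconsP p; rewrite {}pE vcons0 in pp s0 zero_far *.
rewrite dot_vcons -expr2 in pp.
have sLs : sin L < s.
  apply: (above_zone k0 v0 vu _ Lpi s0 pp) => [|j w jk ww cw]; first lra.
  apply: zero_far => //.
  by rewrite /Q (big_rem j) ?mem_iota //= cw mul0r mulr0.
have sp : 0 < s by apply: lt_trans sLs.
exists ((c * s)^-1 *: y).
  have cs0 : 0 < c * s by apply: mulr_gt0.
  rewrite dotZl dotZr mulrA -expr2 exprVn mulrC ler_pdivrMr ?exprn_gt0 //.
  rewrite mul1r exprMn /c expr_div_n mulrAC ler_pdivlMr ?exprn_gt0 // cos2sin2.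
  have : sin L ^+ 2 <= s ^+ 2 by rewrite ler_sqr ?nnegrE ltW.
  have -> : dot y y = 1 - s ^+ 2 by lra.
  by move: (sin L ^+ 2) (s ^+ 2) => e f; lra.
(* A zero z of P is seen from the centre in the direction (1, b), b = c z. *)
move=> z Pz.
have [b bE] : exists b, b = c *: z by exists (c *: z).
have B0 : 0 < 1 + dot b b by have := dot_ge0 b; lra.
pose B := Num.sqrt (1 + dot b b).
have BB : B ^+ 2 = 1 + dot b b by rewrite sqr_sqrtr // ltW.
have Bp : 0 < B by rewrite sqrtr_gt0.
pose w := vcons B^-1 (B^-1 *: b).
have ww : dot w w = 1.
  rewrite dot_vcons dotZl dotZr.
  have -> : B^-1 * B^-1 + B^-1 * (B^-1 * dot b b) = (1 + dot b b) / B ^+ 2.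
    by field; rewrite gt_eqF.
  by rewrite BB divff // gt_eqF.
have Qw : Q w = 0.
  have [_ hH _] := formH.
  have -> : w = B^-1 *: vcons 1 ((c * 1) *: z).
    by rewrite scale_vcons !mulr1 -bE.
  rewrite /Q hH homogenizationE // Pz; ring.
have far : s + dot y b <= B * cos u.
  have := zero_far w ww Qw; rewrite dot_vcons dotZr.
  have -> : s / B + B^-1 * dot y b = (s + dot y b) / B.
    by field; rewrite gt_eqF.
  by rewrite ler_pdivrMr // (mulrC B).
have -> : (c * s)^-1 *: y - z = c^-1 *: (s^-1 *: y - b).
  by rewrite bE scalerBr !scalerA -invfM mulVf ?scale1r // gt_eqF.
set X := s^-1 *: y - b.
have -> : cos L ^+ 2 * dot (c^-1 *: X) (c^-1 *: X) = dot X X * sin L ^+ 2.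
  by rewrite dotZl dotZr /c; field; rewrite (gt_eqF sL) (gt_eqF cL).
by rewrite ler_pM2r ?exprn_gt0 //; apply: gnomonic_dist.
Qed.

(** * Passing to the limit *)

Lemma compact_limit_point (R : realType) (d : nat) (Z : set 'rV[R]_d) (r : R) :
  (forall e, 0 < e -> exists2 x : 'rV[R]_d, dot x x <= 1 &
    forall z, Z z -> r - e <= dot (x - z) (x - z)) ->
  exists2 x : 'rV[R]_d, dot x x <= 1 &
    forall z, Z z -> r <= dot (x - z) (x - z).
Proof.
move=> approx.
pose far e : set 'rV[R]_d := [set x | dot x x <= 1 /\
  forall z, Z z -> r - e <= dot (x - z) (x - z)].
pose F := filter_from [set e : R | 0 < e] far.
have FF : ProperFilter F.
  apply: filter_from_proper; last first.
    by move=> e /approx[x x1 xZ]; exists x.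
  apply: filter_from_filter; first by exists 1 => /=.
  move=> e1 e2 /= e10 e20; exists (Num.min e1 e2).
    by rewrite /= lt_min e10.
  move=> x [x1 xZ]; split; split => // z Zz; apply: le_trans (xZ z Zz);
    by rewrite lerB // ge_min lexx ?orbT.
have Fball : F [set x | dot x x <= 1] by exists 1 => //= x [].
have [p [p1 clp]] := @compact_dot R d 1 F FF Fball.
exists p => // z Zz; rewrite leNgt; apply/negP => lt_r.
pose g y := dot (y - z) (y - z).
have gc : {for p, continuous g}.
  have subc : {for p, continuous (fun y : 'rV[R]_d => y - z)}.
    exact: (cvgB cvg_id (cvg_cst z)).
  exact: (continuous_comp subc (@continuous_dot R d (p - z))).
pose e := (r - g p) / 2; have e0 : 0 < e by rewrite divr_gt0 // subr_gt0.
have near_p : nbhs p [set y | g y < r - e].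
  apply: (cvgr_lt _ gc); have : g p < r by [].
  by rewrite /e; lra.
have [|y [[_ yZ] /= ygt]] := clp (far e) _ _ near_p; first by exists e.
by have := yZ z Zz; rewrite leNgt ygt.
Qed.

Lemma norm_sin_natmul (R : realType) (n : nat) (x : R) :
  `|sin (n%:R * x)| <= n%:R * `|sin x|.
Proof.
elim: n => [|n IHn]; first by rewrite !mul0r sin0 normr0.
rewrite -natr1 !mulrDl !mul1r sinD (le_trans (ler_normD _ _)) // !normrM.
have := cos_max x; have := cos_max (n%:R * x).
have := normr_ge0 (sin x); have := normr_ge0 (sin (n%:R * x)).
move=> a0 b0 c1 d1; apply: lerD; last exact: ler_piMl.
by apply: le_trans IHn; apply: ler_piMr.
Qed.

(** As v tends to u, cos L tends to sin (n u), so the bound of [ball_point] tends to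
    sin u ^ 2 / sin (n u) ^ 2 - sin u ^ 2 >= 1 / n ^ 2 - sin u ^ 2; half of
    e pays for sin u ^ 2 (k large), the other half for v < u. *)
Lemma ball_point_approx (R : realType) (d n : nat) (P : {mpoly R[d]}) (e : R) :
  P != 0 -> (msize P <= n.+1)%N -> (0 < n)%N -> 0 < e ->
  exists2 x : 'rV[R]_d, dot x x <= 1 &
    forall z : 'rV[R]_d, P.@[fun i => z ord0 i] = 0 ->
      n%:R ^- 2 - e <= dot (x - z) (x - z).
Proof.
move=> P0 szP n0 e0; have pi0 := pi_gt0 R.
have nR : 0 < n%:R :> R by rewrite ltr0n.
have [k k0 sinu] : exists2 k, (0 < k)%N &
    sin (pi / ((n + k.*2)%:R *+ 2)) ^+ 2 < e / 2 :> R.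
  have sin2c : {for 0, continuous (fun u : R => sin u * sin u)}.
    by have s0 := @continuous_sin R 0; exact: (cvgM s0 s0).
  have : nbhs (0 : R) [set u : R | sin u * sin u < e / 2].
    by apply: (cvgr_lt _ sin2c); rewrite sin0 mul0r divr_gt0.
  case/nbhs_ballP => rho /= rho0 sub.
  (* Any k with pi / rho < k makes u < rho. *)
  exists (Num.bound (pi / rho)).+1 => //.
  rewrite expr2; apply: sub; rewrite /ball /= sub0r normrN.
  set M := (n + _)%N; have M0 : (0 < M)%N by rewrite addn_gt0 n0.
  have MR : 0 < M%:R :> R by rewrite ltr0n.
  rewrite ger0_norm; last by rewrite divr_ge0 ?pi_ge0 ?mulrn_wge0 ?ler0n.
  rewrite ltr_pdivrMr ?pmulrn_lgt0 //.
  have : pi / rho < M%:R.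
    apply: lt_le_trans (archi_boundP _) _; first by rewrite divr_ge0 ?ltW.
    rewrite ler_nat /M; apply: leq_trans (leq_addl _ _).
    by rewrite -addnn leqW // leq_addr.
  rewrite ltr_pdivrMr // -mulr_natr => ltM; apply: lt_trans ltM _.
  by rewrite mulrC ltr_pM2l // mulr_natr mulr2n ltrDl.
set N := (n + k.*2)%N in sinu; set u := pi / _ in sinu.
have N0 : (0 < N)%N by rewrite addn_gt0 n0.
have NR : 0 < N%:R :> R by rewrite ltr0n.
have u0 : 0 < u by rewrite divr_gt0 // pmulrn_lgt0.
have uN : (k.*2)%:R * u = pi / 2 - n%:R * u.
  have : u * N%:R = pi / 2.
    by rewrite /u -mulr_natr invfM mulrA mulrAC divfK // gt_eqF.
  by rewrite /N natrD => <-; ring.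
have nupi : 0 < n%:R * u < pi / 2.
  rewrite mulr_gt0 //= -subr_gt0 -uN mulr_gt0 // ltr0n double_gt0 //.
have sn : 0 < sin (n%:R * u) by rewrite sin_gt0_pihalf.
have cosLE : cos ((k.*2)%:R * u) = sin (n%:R * u).
  by rewrite uN cosB cos_pihalf sin_pihalf mul0r add0r mul1r.
have sinLE : sin ((k.*2)%:R * u) = cos (n%:R * u).
  by rewrite uN sinB cos_pihalf sin_pihalf mul0r subr0 mul1r.
pose f v := sin u ^+ 2 * sin ((k.*2)%:R * v) ^+ 2 / cos ((k.*2)%:R * v) ^+ 2.
have fu : n%:R ^- 2 - sin u ^+ 2 <= f u.
  rewrite /f sinLE cosLE cos2sin2.
  have s2 : sin (n%:R * u) ^+ 2 <= n%:R ^+ 2 * sin u ^+ 2.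
    rewrite -exprMn -(real_normK (num_real (sin (n%:R * u)))).
    rewrite -(real_normK (num_real (n%:R * sin u))).
    by rewrite ler_sqr ?nnegrE // normrM normr_nat norm_sin_natmul.
  rewrite ler_pdivlMr ?exprn_gt0 //.
  rewrite mulrBl mulrBr mulr1 lerD2r mulrC ler_pdivrMr ?exprn_gt0 //.
  by rewrite (mulrC (sin u ^+ 2)).
have fc : {for u, continuous f}.
  have lin : {for u, continuous (fun v : R => (k.*2)%:R * v)}.
    exact: mulrl_continuous.
  have sc := continuous_comp lin (@continuous_sin R _).
  have cc := continuous_comp lin (@continuous_cos R _).
  have ucst : {for u, continuous (fun _ : R => sin u ^+ 2)} by exact: cvg_cst.
  apply: (cvgM (cvgM ucst (cvgM sc sc)) (cvgV _ (cvgM cc cc))).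
  by rewrite /= cosLE mulf_neq0 // gt_eqF.
have [v /andP[v0 vu] fv] : exists2 v, 0 < v < u & f u - e / 2 < f v.
  have : nbhs u [set v | f u - e / 2 < f v].
    by apply: (cvgr_gt _ fc); rewrite ltrBlDr ltrDl divr_gt0.
  case/nbhs_ballP => rho /= rho0 sub.
  have m0 : 0 < Num.min rho u by rewrite lt_min rho0.
  have m1 : Num.min rho u <= rho by rewrite ge_min lexx.
  have m2 : Num.min rho u <= u by rewrite ge_min lexx orbT.
  exists (u - Num.min rho u / 2); first by apply/andP; split; lra.
  by apply: sub; rewrite /ball /= opprB addrC subrK gtr0_norm; lra.
have [x x1 xZ] := ball_point P0 szP n0 k0 v0 vu.
exists x => // z Pz; have := xZ z Pz; rewrite -/N -/u mulrC [leRHS]mulrC.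
have cL : 0 < cos ((k.*2)%:R * v).
  rewrite cos_gt0_pihalf //.
  have k2 : 0 < (k.*2)%:R :> R by rewrite ltr0n double_gt0.
  have : (k.*2)%:R * v < (k.*2)%:R * u by rewrite ltr_pM2l.
  by have := mulr_gt0 k2 v0; move/andP: nupi; lra.
rewrite (mulrC (sin _ ^+ 2)) -ler_pdivrMr ?exprn_gt0 // -/(f v); lra.
Qed.

(* [msize P] is the total degree plus one. *)
Theorem corollary1p7 (R : realType) (d n : nat)
    (hd : (1 <= d)%N) (hn : (1 <= n)%N)
    (P : {mpoly R[d]}) (hP : P != 0) (hdeg : msize P = n.+1) :
  exists2 x : 'rV[R]_d,
    unit_ball x & at_distance_ge (n%:R^-1) x (zero_set P).
Proof.
have szP : (msize P <= n.+1)%N by rewrite hdeg.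
have [x x1 xZ] := compact_limit_point
  (fun e => ball_point_approx hP szP hn (e := e)).
exists x; first by rewrite /unit_ball /= enormE -sqrtr1 ler_sqrt.
move=> z Zz; rewrite enormE -[n%:R^-1]ger0_norm ?invr_ge0 ?ler0n //.
by rewrite -sqrtr_sqr ler_sqrt ?dot_ge0 // exprVn xZ.
Qed.
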